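(* For every $z\in\mathbb C\setminus\{\pm1\}$ the cyclic representation $\widetilde T_z\subseteq T_z$ of $G$ generated by the distinguished vector is reducible.
   Context: $S(n)$ is the group of permutations of $\{1,\dots,n\}$, identified with the stabilizer of $n+1$ in $S(n+1)$; $S(\infty)=\bigcup_n S(n)$; $G=S(\infty)\times S(\infty)$, $G(n)=S(n)\times S(n)$. The canonical projection $p_{n,n+1}:S(n+1)\to S(n)$ removes $n+1$ from its cycle: for $1\le i\le n$, $(p_{n,n+1}(x))(i)=x(i)$ if $x(i)\le n$, and $=x(n+1)$ if $x(i)=n+1$. $H^n=L^2(S(n))$ with respect to the uniform probability measure; $\mathrm{Reg}^n$ is the representation of $G(n)$ in $H^n$, $(\mathrm{Reg}^n(g)f)(x)=f(g_2^{-1}xg_1)$. For $z\in\mathbb C$, $t=|z|^2$, the isometric $G(n)$-equivariant embedding $L_z^n:H^n\to H^{n+1}$ is $(L_z^nf)(x)=z\sqrt{\frac{n+1}{t+n}}f(x)$ for $x\in S(n)$ and $(L_z^nf)(x)=\sqrt{\frac{n+1}{t+n}}f(p_{n,n+1}(x))$ for $x\in S(n+1)\setminus S(n)$. The generalized regular representation $T_z$ of $G$ is the inductive limit of the $\mathrm{Reg}^n$ along the $L_z^n$; it acts in the Hilbert completion of $\bigcup_nH^n$. For $s\in S(n)$, $[s]$ is the number of cycles. The distinguished vector of $T_z$ ($z\ne0$) is the unit vector represented, in each $H^n$, by the function $F_z^n(x)=\left(\frac{n!}{t(t+1)\cdots(t+n-1)}\right)^{1/2}z^{[x]}$ (one has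 $L_z^nF_z^n=F_z^{n+1}$). For $z=0$ it is represented (up to a scalar factor of modulus 1) by $F_0^n(x)=\sqrt n$ if $x$ is an $n$-cycle and $F_0^n(x)=0$ otherwise. $\widetilde T_z$ is the subrepresentation of $T_z$ in the closed linear span of the $G$-orbit of the distinguished vector. *)

(* Defs.v *)
From HB Require Import structures.
From mathcomp Require Import all_boot all_order all_algebra all_fingroup.
From mathcomp Require Import complex.
From mathcomp Require Import all_classical all_reals all_analysis.

Set Implicit Arguments.
Unset Strict Implicit.
Unset Printing Implicit Defensive.

Import Order.TTheory GRing.Theory Num.Theory.
Import numFieldNormedType.Exports.

Local Open Scope classical_set_scope.
Local Open Scope ring_scope.

(* The letters 1, 2, 3, ... are shifted to 0, 1, 2, ..., so that S(n) is 'S_n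
   acting on 'I_n. *)
Record Sinf := MkSinf {
  sinf_fun :> nat -> nat;
  sinf_inv : nat -> nat;
  sinf_funK : cancel sinf_fun sinf_inv;
  sinf_invK : cancel sinf_inv sinf_fun;
  sinf_fin : exists n : nat, forall i : nat, (n <= i)%N -> sinf_fun i = i
}.

Lemma sinf_eq (s t : Sinf) : sinf_fun s =1 sinf_fun t -> s = t.
Proof.
case: s => s s' sK s'K sf; case: t => t t' tK t'K tf /= /funext st.
move: sK s'K sf; rewrite st => sK s'K sf.
have st' : s' = t' by apply/funext => i; rewrite -[in LHS](t'K i) sK.
move: sK s'K; rewrite st' => sK s'K.
by congr MkSinf; apply: Prop_irrelevance.
Qed.

HB.instance Definition _ := gen_eqMixin Sinf.
HB.instance Definition _ := gen_choiceMixin Sinf.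

Lemma sinf_one_fin : exists n : nat, forall i : nat, (n <= i)%N -> id i = i.
Proof. by exists 0%N. Qed.

Definition sinf_one : Sinf :=
  @MkSinf id id (fun=> erefl) (fun=> erefl) sinf_one_fin.

Lemma sinf_mul_fin (s t : Sinf) :
  exists n : nat, forall i : nat, (n <= i)%N -> (s \o t) i = i.
Proof.
have [m sm] := sinf_fin s; have [n tn] := sinf_fin t.
by exists (maxn m n) => i; rewrite geq_max => /andP[mi ni] /=; rewrite tn// sm.
Qed.

Definition sinf_mul (s t : Sinf) : Sinf :=
  @MkSinf (s \o t) (sinf_inv t \o sinf_inv s)
    (can_comp (@sinf_funK s) (@sinf_funK t))
    (can_comp (@sinf_invK t) (@sinf_invK s)) (sinf_mul_fin s t).

Lemma sinf_opp_fin (s : Sinf) :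
  exists n : nat, forall i : nat, (n <= i)%N -> sinf_inv s i = i.
Proof.
have [n sn] := sinf_fin s.
by exists n => i ni; rewrite -[in LHS](sn i ni) sinf_funK.
Qed.

Definition sinf_opp (s : Sinf) : Sinf :=
  MkSinf (@sinf_invK s) (@sinf_funK s) (sinf_opp_fin s).

Lemma sinf_mulA : associative sinf_mul.
Proof. by move=> s t u; apply: sinf_eq. Qed.
Lemma sinf_mul1 : left_id sinf_one sinf_mul.
Proof. by move=> s; apply: sinf_eq. Qed.
Lemma sinf_mulr1 : right_id sinf_one sinf_mul.
Proof. by move=> s; apply: sinf_eq. Qed.
Lemma sinf_mulV : left_inverse sinf_one sinf_opp sinf_mul.
Proof. by move=> s; apply: sinf_eq => i /=; rewrite sinf_funK. Qed.
Lemma sinf_mulrV : right_inverse sinf_one sinf_opp sinf_mul.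
Proof. by move=> s; apply: sinf_eq => i /=; rewrite sinf_invK. Qed.

(* The product of S(oo) is composition of functions, (s * t) i = s (t i),
   whereas in 'S_n the product is (s * t) i = t (s i). *)
HB.instance Definition _ := isGroup.Build Sinf
  sinf_mulA sinf_mul1 sinf_mulr1 sinf_mulV sinf_mulrV.

Definition Ginf : groupType := (Sinf * Sinf)%type.

Definition ext_fun n (s : 'S_n) (i : nat) : nat :=
  if insub i is Some j then nat_of_ord (s j) else i.

Lemma ext_funK n (s : 'S_n) : cancel (ext_fun s) (ext_fun s^-1%g).
Proof.
rewrite /ext_fun => i; case: (@insubP _ _ 'I_n i) => [j _ <-|ni].
  by rewrite (valK (s j)) permK.
by rewrite insubN.
Qed.

Lemma ext_funVK n (s : 'S_n) : cancel (ext_fun s^-1%g) (ext_fun s).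
Proof. by move=> i; rewrite -[s in ext_fun s _]invgK ext_funK. Qed.

Lemma ext_fun_fin n (s : 'S_n) :
  exists m : nat, forall i : nat, (m <= i)%N -> ext_fun s i = i.
Proof. by exists n => i ni; rewrite /ext_fun insubN// -leqNgt. Qed.

Definition ext_sinf n (s : 'S_n) : Sinf :=
  MkSinf (ext_funK s) (ext_funVK s) (ext_fun_fin s).

Definition ext_ginf n (g : 'S_n * 'S_n) : Ginf := (ext_sinf g.1, ext_sinf g.2).

(* [ord_max : 'I_n.+1] is the letter n+1, and [lift ord_max] is the inclusion of
   {1, ..., n} in {1, ..., n+1}; the default value [i] is never reached. *)
Definition cycle_proj_fun n (x : 'S_n.+1) (i : 'I_n) : 'I_n :=
  if unlift ord_max (x (lift ord_max i)) is Some k then k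
  else odflt i (unlift ord_max (x ord_max)).

Lemma lift_cycle_proj_fun n (x : 'S_n.+1) (i : 'I_n) :
  lift ord_max (cycle_proj_fun x i) =
  if x (lift ord_max i) == ord_max then x ord_max else x (lift ord_max i).
Proof.
rewrite /cycle_proj_fun; case: unliftP => [k ->|xi].
  by rewrite eq_sym (negPf (neq_lift _ _)).
rewrite xi eqxx; case: unliftP => [k ->//|xm].
by have /eqP := neq_lift ord_max i; case; apply: (@perm_inj _ x); rewrite xm xi.
Qed.

Lemma cycle_proj_fun_inj n (x : 'S_n.+1) : injective (cycle_proj_fun x).
Proof.
move=> i j /(congr1 (lift ord_max)); rewrite !lift_cycle_proj_fun.
have ne k : (lift ord_max k == ord_max :> 'I_n.+1) = false.
  by rewrite eq_sym (negPf (neq_lift _ _)).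
case: eqP => [xi|_]; case: eqP => [xj|_].
- by move=> _; apply/(@lift_inj _ ord_max)/(@perm_inj _ x); rewrite xi xj.
- by move/perm_inj/eqP; rewrite eq_sym ne.
- by move/perm_inj/eqP; rewrite ne.
- by move/perm_inj/lift_inj.
Qed.

Definition cycle_proj n (x : 'S_n.+1) : 'S_n := perm (@cycle_proj_fun_inj n x).

Section FiniteLevel.
Variable R : realType.
Implicit Type z : R[i].

Definition Hn n : lmodType R[i] := {ffun 'S_n -> R[i]^o}.

Definition L2dot n (f g : Hn n) : R[i] :=
  (n`!%:R)^-1 * \sum_(x : 'S_n) f x * (g x)^*%R.

(* The composite function g_2^-1 o x o g_1 is [g.1 * x * g.2^-1] in 'S_n. *)
Definition Reg n (g : 'S_n * 'S_n) (f : Hn n) : Hn n :=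
  [ffun x : 'S_n => f (g.1 * x * g.2^-1)%g].

Definition tpar z : R[i] := `|z| ^+ 2.

(* For x in S(n), i.e. x fixing [ord_max], [cycle_proj x] is x itself viewed in 'S_n. *)
Definition Lz z n (f : Hn n) : Hn n.+1 :=
  [ffun x : 'S_n.+1 =>
     let c := sqrtC (n.+1%:R / (tpar z + n%:R)) in
     if x ord_max == ord_max then z * c * f (cycle_proj x) else c * f (cycle_proj x)].

Definition cycles n (x : 'S_n) : nat := #|porbits x|.

Definition Fz z n : Hn n :=
  [ffun x : 'S_n =>
     if z == 0 then (if cycles x == 1%N then sqrtC n%:R else 0)
     else sqrtC (n`!%:R / \prod_(i < n) (tpar z + i%:R)) * z ^+ cycles x].

End FiniteLevel.

Record hilbert (R : realType) := Hilbert {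
  hspace :> completeNormedModType R[i];
  hdot : {dot hspace for Num.conj};
  hdot_norm : forall u : hspace, hdot u u = `|u| ^+ 2
}.

Record unitary_rep (R : realType) (G : groupType) (V : hilbert R) := UnitaryRep {
  rep_fun :> G -> {linear V -> V};
  rep1 : forall u : V, rep_fun 1%g u = u;
  repM : forall (g h : G) (u : V), rep_fun (g * h)%g u = rep_fun g (rep_fun h u);
  rep_dot : forall (g : G) (u v : V), hdot V (rep_fun g u) (rep_fun g v) = hdot V u v
}.

Section Subrepresentations.
Variables (R : realType) (G : groupType) (V : hilbert R) (T : unitary_rep G V).

Definition is_subspace (W : set V) : Prop :=
  W 0 /\ forall (a : R[i]) (u v : V), W u -> W v -> W (a *: u + v).

Definition is_subrep (W : set V) : Prop :=
  [/\ is_subspace W, closed W & forall (g : G) (u : V), W u -> W (T g u)].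

Definition closed_span (A : set V) : set V := closure (smallest is_subspace A).

Definition rep_orbit (u : V) : set V := [set T g u | g in [set: G]].

Definition cyclic_subrep (u : V) : set V := closed_span (rep_orbit u).

Definition reducible (K : set V) : Prop :=
  exists W : set V, [/\ is_subrep W, W `<=` K, W != [set 0] & W != K].

End Subrepresentations.

(* A Hilbert space completing the union of the H^n (n >= 1) along the L_z^n, with
   the representation extending the Reg^n.  It is determined up to unitary
   equivalence; H^0 is left out because L_0^0 is not isometric, so [incl 0] is
   unconstrained. *)
Record genreg (R : realType) (z : R[i]) := GenReg {
  genreg_space : hilbert R;
  genreg_rep :> unitary_rep Ginf genreg_space;
  incl : forall n, {linear Hn R n -> genreg_space};
  incl_dot : forall n (f g : Hn R n), (0 < n)%N ->
    hdot genreg_space (incl n f) (incl n g) = L2dot f g;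
  incl_L : forall n (f : Hn R n), (0 < n)%N -> incl n.+1 (Lz z f) = incl n f;
  incl_rep : forall n (g : 'S_n * 'S_n) (f : Hn R n), (0 < n)%N ->
    genreg_rep (ext_ginf g) (incl n f) = incl n (Reg g f);
  incl_dense : closure (\bigcup_(n in [set n | (0 < n)%N]) range (incl n)) = setT
}.

Definition is_distinguished (R : realType) (z : R[i]) (T : genreg z)
    (xi : genreg_space T) : Prop :=
  forall n, (0 < n)%N -> xi = incl T n (Fz z n).

(* Main.v *)
Require Import Defs.
From mathcomp Require Import all_boot all_order all_algebra all_fingroup.
From mathcomp Require Import complex.
From mathcomp Require Import all_classical all_reals all_analysis.
From mathcomp Require Import ring zify.

Set Implicit Arguments.
Unset Strict Implicit.
Unset Printing Implicit Defensive.

Import Order.TTheory GRing.Theory Num.Theory.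
Import numFieldNormedType.Exports.

Local Open Scope classical_set_scope.
Local Open Scope ring_scope.

(** Let [tau j] be the transposition of the letters [2j] and [2j+1] in the first
    factor of [G].  These are involutions, and each element of [G] commutes with
    all but finitely many of them.  The functions [Fz z n] are central, so the
    distinguished vector [xi] is fixed by the diagonal of [G], and conjugation by
    the diagonal carries any pair of the [tau j] to any other pair.  Hence
    [<T (tau i) xi, T (tau j) xi>] has one value [q] for all [i != j], and
    [<T (tau j) xi, xi>] has one value [c] for all [j].

    As in the law of large numbers, the Cesaro means of the [T (tau j)] then
    converge strongly on the cyclic subspace [K] of [xi].  The limit [C] is a
    self-adjoint contraction of [K] that commutes with [G], and
    [<C xi, xi> = c], [|C xi|^2 = q].  If [q * |xi|^2 != c^2], then [xi] is not an
    eigenvector of [C], so [C] is not a scalar, and [K] is reducible by Schur's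
    lemma: this is [reducible_of_variance].

    Only one consequence of the spectral theorem is used in that step, and
    [reducible_of_intertwiner] obtains it from a square root.  Let [S] be [C]
    shifted so that [<S xi, xi> = 0] and rescaled to a contraction, and let
    [A = sqrt (S^2)].  As [(A - S) (A + S) = 0], the kernel of [A - S] is a
    nontrivial invariant subspace of [K], unless [A = S] or [A = - S] on [K].  In
    these two cases [<A xi, xi> = 0], and [0 <= A <= 1] gives [A xi = 0], so
    [S xi = 0] and [xi] is an eigenvector of [C] after all.

    The numbers [c], [q] and [|xi|^2] are sums over [S(4)], evaluated by listing
    the 24 permutations.  For [z != 0] the quantity [q * |xi|^2 - c^2] is a
    nonzero multiple of [|1 - z|^2 * |1 + z|^2] ([variance_S4]), which vanishes
    only at [z = 1] and [z = -1].  For [z = 0] only 4-cycles contribute: [c = 0]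
    by parity, while [q] and [|xi|^2] are positive. *)

(** * Limits and inner products *)

Section Limits.
Variable R : realType.

(** The archimedean property of [R] passes to the partially ordered field [R[i]],
    whose positive elements are real. *)
Lemma invn_small (e : R[i]) :
  0 < e -> exists N : nat, forall n, (N <= n)%N -> n.+1%:R^-1 <= e.
Proof.
case: e => a b; rewrite ltcE /= => /andP[/eqP-> a0].
have [N Na] := ltr_add_invr a0; rewrite add0r in Na.
exists N => n Nn; apply: (@le_trans _ _ (N.+1%:R^-1)).
  by rewrite lef_pV2 ?posrE ?ltr0n// ler_nat ltnS.
have -> : (N.+1%:R^-1 : R[i]) = (N.+1%:R^-1)%:C%C by rewrite fmorphV rmorph_nat.
by rewrite lecR ltW.
Qed.

Lemma cvgn_rate (V : pseudoMetricNormedZmodType R[i]) (u : nat -> V) (l : V)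
    (k : R[i]) :
  (forall n, `|u n - l| <= k / n.+1%:R) -> u @ \oo --> l.
Proof.
move=> ul; apply/cvgrPdistC_le => e e0.
have k0 : 0 <= k by have := le_trans (normr_ge0 _) (ul 0%N); rewrite divr1.
have [N Ne] := invn_small (divr_gt0 e0 (ltr_pwDr ltr01 k0)).
exists N => // n /= Nn; apply: le_trans (ul n) _.
apply: (@le_trans _ _ ((k + 1) * n.+1%:R^-1)).
  by rewrite ler_wpM2r// ?invr_ge0// lerDl.
rewrite mulrC -ler_pdivlMr ?ltr_pwDr//; exact: Ne.
Qed.

Variable V : completeNormedModType R[i].

Lemma closure_normP (A : set V) (v : V) :
  closure A v <-> forall e : R[i], 0 < e -> exists2 w, A w & `|v - w| < e.
Proof.
split=> [Av e e0|Av B].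
  have [w [Aw]] := Av _ (nbhsx_ballx v e e0).
  by rewrite -ball_normE /= => vw; exists w.
rewrite -nbhs_ballE => -[e /= e0 eB]; have [w Aw vw] := Av e e0.
by exists w; split=> //; apply: eB; rewrite -ball_normE.
Qed.

Lemma cvgn_cauchy (u : nat -> V) :
  (forall e : R[i], 0 < e ->
    exists N, forall m, (N <= m)%N -> `|u m - u N| <= e) -> cvgn u.
Proof.
move=> uc; apply: cauchy_cvg; apply: cauchy_exP => e e0.
have [N uN] := uc (e / 2) (divr_gt0 e0 (ltr0Sn _ 1)).
exists (u N), N => // m /= Nm; rewrite -ball_normE /= distrC.
by apply: le_lt_trans (uN m Nm) _; rewrite ltr_pdivrMr// ltr_pMr// ltr1n.
Qed.

Lemma le_norm_lim (u : nat -> V) (l : V) (k : R[i]) :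
  (\forall n \near \oo, `|u n| <= k) -> u @ \oo --> l -> `|l| <= k.
Proof.
move=> uk /cvgrPdist_le ul; apply/ler_addgt0Pl => e e0.
near \oo => n.
rewrite -(subrK (u n) l) (le_trans (ler_normD _ _))// lerD//; near: n => //.
exact: ul.
Unshelve. all: by end_near.
Qed.

End Limits.

Section Dot.
Variables (R : realType) (V : hilbert R).
Local Notation "''[' u , v ]" := (hdot V u v).

Lemma hdotC (u v : V) : '[u, v] = ('[v, u])^*%R.
Proof. by rewrite hermC expr0 mul1r. Qed.

Lemma hdotDl (u v w : V) : '[u + v, w] = '[u, w] + '[v, w].
Proof. exact: linearDl. Qed.

Lemma hdotBl (u v w : V) : '[u - v, w] = '[u, w] - '[v, w].
Proof. exact: linearBl. Qed.

Lemma hdotBr (u v w : V) : '[u, v - w] = '[u, v] - '[u, w].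
Proof. exact: linearBr. Qed.

Lemma hdotZl a (u v : V) : '[a *: u, v] = a * '[u, v].
Proof. exact: linearZl_LR. Qed.

Lemma hdotZr a (u v : V) : '[u, a *: v] = a^*%R * '[u, v].
Proof. exact: linearZr_LR. Qed.

Lemma hdot_suml n (f : 'I_n -> V) (v : V) :
  '[\sum_i f i, v] = \sum_i '[f i, v].
Proof.
elim/big_rec2: _ => [|i y1 y2 _ <-]; first exact: linear0l.
exact: hdotDl.
Qed.

Lemma hdot_sumr n (f : 'I_n -> V) (v : V) :
  '[v, \sum_i f i] = \sum_i '[v, f i].
Proof.
rewrite hdotC hdot_suml rmorph_sum; apply: eq_bigr => i _.
by rewrite /= [RHS]hdotC.
Qed.

(** The usual argument: [|u - a v|^2 >= 0] for the [a] that projects [u] on [v]. *)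
Lemma hdot_CauchySchwarz (u v : V) : `|'[u, v]| <= `|u| * `|v|.
Proof.
have [->|v0] := eqVneq v 0.
  by rewrite [X in `|X|](linear0r (hdot V) u) !normr0 mulr0.
have n0 : `|v| ^+ 2 != 0 by rewrite expf_neq0// normr_eq0.
rewrite -(@ler_pXn2r _ 2)// ?nnegrE ?mulr_ge0// exprMn.
rewrite -ler_pdivrMr ?exprn_gt0 ?normr_gt0// -subr_ge0.
pose a := '[u, v] / `|v| ^+ 2.
suff -> : `|u| ^+ 2 - `|'[u, v]| ^+ 2 / `|v| ^+ 2 = `|u - a *: v| ^+ 2.
  exact: exprn_ge0.
have aC : a^*%R = ('[u, v])^*%R / `|v| ^+ 2.
  by rewrite rmorphM fmorphV rmorphXn /= (CrealP (normr_real v)).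
rewrite -(hdot_norm (u - _)) hdotBl !hdotBr !hdotZl !hdotZr !hdot_norm.
by rewrite aC -(hdotC v u) (hdotC v u) normCK /a; field; rewrite normr_eq0.
Qed.

Lemma norm2B (u v : V) :
  `|u - v| ^+ 2 = `|u| ^+ 2 - ('[u, v] + ('[u, v])^*%R) + `|v| ^+ 2.
Proof.
by rewrite -!hdot_norm hdotBl !hdotBr -(hdotC v u); ring.
Qed.

Lemma cvg_hdotl (u : nat -> V) (l v : V) :
  u @ \oo --> l -> '[u n, v] @[n --> \oo] --> '[l, v].
Proof.
move=> /cvgrPdistC_le ul; apply/cvgrPdistC_le => e e0.
have k0 : 0 < `|v| + 1 by rewrite ltr_wpDl.
have := ul _ (divr_gt0 e0 k0); apply: filterS => n un.
rewrite -hdotBl; apply: le_trans (hdot_CauchySchwarz _ _) _.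
apply: (@le_trans _ _ (`|u n - l| * (`|v| + 1))).
  by rewrite ler_wpM2l// lerDl.
by rewrite -ler_pdivlMr.
Qed.

Lemma cvg_hdotr (u : nat -> V) (l v : V) :
  u @ \oo --> l -> '[v, u n] @[n --> \oo] --> '[v, l].
Proof.
move=> /cvgrPdistC_le ul; apply/cvgrPdistC_le => e e0.
have k0 : 0 < `|v| + 1 by rewrite ltr_wpDl.
have := ul _ (divr_gt0 e0 k0); apply: filterS => n un.
rewrite -hdotBr; apply: le_trans (hdot_CauchySchwarz _ _) _.
apply: (@le_trans _ _ ((`|v| + 1) * `|u n - l|)).
  by rewrite ler_wpM2r// lerDl.
by rewrite mulrC -ler_pdivlMr.
Qed.

End Dot.

(** * Bounded operators on a subspace *)

Section Subspaces.
Variables (R : realType) (V : hilbert R).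
Implicit Type K : set V.

Lemma subspace0 K : is_subspace K -> K 0. Proof. by case. Qed.

Lemma subspaceZ K a v : is_subspace K -> K v -> K (a *: v).
Proof. by move=> [K0 KP] Kv; rewrite -[_ *: _]addr0; exact: KP. Qed.

Lemma subspaceD K u v : is_subspace K -> K u -> K v -> K (u + v).
Proof. by move=> [K0 KP] Ku Kv; rewrite -[u]scale1r; exact: KP. Qed.

Lemma subspaceB K u v : is_subspace K -> K u -> K v -> K (u - v).
Proof.
by move=> sK Ku Kv; apply: subspaceD => //; rewrite -scaleN1r; exact: subspaceZ.
Qed.

(** Operators are functions on the whole of [V] that are constrained on [K] only:
    the operators needed below are pointwise limits that exist on [K] but possibly
    not outside of it. *)
Definition operator_on K (M : R[i]) (f : V -> V) : Prop :=
  [/\ forall v, K v -> K (f v),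
      forall a u v, K u -> K v -> f (a *: u + v) = a *: f u + f v &
      forall v, K v -> `|f v| <= M * `|v|].

Section OperatorOn.
Variables (K : set V) (sK : is_subspace K).

Lemma operator_onB M f u v :
  operator_on K M f -> K u -> K v -> f (u - v) = f u - f v.
Proof.
by move=> [_ fl _] Ku Kv; rewrite addrC -scaleN1r fl// scaleN1r addrC.
Qed.

Lemma operator_onZ M f a v : operator_on K M f -> K v -> f (a *: v) = a *: f v.
Proof.
move=> [_ fl _] Kv; have K0 := subspace0 sK.
have f0 : f 0 = 0.
  have := fl 1 0 0 K0 K0; rewrite !scale1r add0r.
  move=> /(congr1 (fun x => x - f 0)).
  by rewrite subrr addrK.
by rewrite -[a *: v]addr0 fl// f0 addr0.
Qed.

Lemma operator_onD M f u v :
  operator_on K M f -> K u -> K v -> f (u + v) = f u + f v.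
Proof. by move=> [_ fl _] Ku Kv; rewrite -{1}[u]scale1r fl// scale1r. Qed.

Lemma operator_on_comp M N f g : 0 <= M ->
  operator_on K M f -> operator_on K N g -> operator_on K (M * N) (f \o g).
Proof.
move=> M0 [fK fl fM] [gK gl gN]; split=> [v Kv|a u v Ku Kv|v Kv] /=.
- exact/fK/gK.
- by rewrite gl// fl//; exact: gK.
- by rewrite (le_trans (fM _ (gK _ Kv)))// -mulrA ler_wpM2l// gN.
Qed.

Lemma operator_onDZ M N a f g :
  operator_on K M f -> operator_on K N g ->
  operator_on K (`|a| * M + N) (fun v => a *: f v + g v).
Proof.
move=> [fK fl fM] [gK gl gN]; split=> [v Kv|b u v Ku Kv|v Kv] /=.
- by have [_] := sK; apply; [exact: fK|exact: gK].
- rewrite gl// fl// !scalerDr !scalerA (mulrC b a) -!addrA; congr (_ + _).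
  by rewrite addrCA.
- rewrite (le_trans (ler_normD _ _))// mulrDl lerD ?gN// normrZ -mulrA.
  by rewrite ler_wpM2l// fM.
Qed.

Lemma operator_on_id : operator_on K 1 id.
Proof. by split=> // v _; rewrite mul1r. Qed.

Lemma operator_on0 : operator_on K 0 (fun=> 0).
Proof.
split=> [v _|a u v _ _|v _]; [exact: subspace0|by rewrite scaler0 addr0|].
by rewrite normr0 mul0r.
Qed.

Lemma operator_on_le M N f : M <= N -> operator_on K M f -> operator_on K N f.
Proof.
move=> MN [fK fl fM]; split=> // v Kv.
by rewrite (le_trans (fM v Kv))// ler_wpM2r.
Qed.

Lemma operator_on_lim M (f : nat -> V -> V) g : closed K ->
  (forall n, operator_on K M (f n)) ->
  (forall v, K v -> f n v @[n --> \oo] --> g v) -> operator_on K M g.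
Proof.
move=> cK fo fg; split=> [v Kv|a u v Ku Kv|v Kv].
- apply: (closed_cvg K cK _ (g v) (fg v Kv)).
  by apply: nearW => n; have [+ _ _] := fo n; apply.
- have Kauv : K (a *: u + v) by case: sK => _; apply.
  apply: (cvg_unique (@norm_hausdorff _ V) (fg _ Kauv)).
  have -> : (fun n => f n (a *: u + v)) = (fun n => a *: f n u + f n v).
    by apply/funext => n; have [_ -> //] := fo n.
  by apply: cvgD (fg v Kv); exact: cvgZr (fg u Ku).
- apply: le_norm_lim (fg v Kv).
  by apply: nearW => n; have [_ _] := fo n; apply.
Qed.

End OperatorOn.
End Subspaces.

(** * Square roots of positive operators *)

(** For a contraction [B], the sequence [sqrt_iter] converges to [1 - sqrt (1 - B)],
    as the fixed point equation [Z = (B + Z^2) / 2] says that [(1 - Z)^2 = 1 - B].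
    Replacing [B] by 1 gives the scalar sequence [sqrt_bound], which increases to 1
    and dominates both the norms and the increments of [sqrt_iter]. *)
Section SquareRoot.
Variables (R : realType) (V : hilbert R) (K : set V).
Hypotheses (sK : is_subspace K) (cK : closed K).
Variables (B : V -> V) (Bop : operator_on K 1 B).

Fixpoint sqrt_iter n (v : V) : V :=
  if n is m.+1 then 2^-1 *: (B v + sqrt_iter m (sqrt_iter m v)) else 0.

Fixpoint sqrt_bound n : R[i] :=
  if n is m.+1 then 2^-1 * (1 + sqrt_bound m ^+ 2) else 0.

Definition sqrt_compl (v : V) : V := lim (sqrt_iter n v @[n --> \oo]).

Local Notation Z := sqrt_iter.
Local Notation a := sqrt_bound.

Lemma sqrt_bound_ge0 n : 0 <= a n.
Proof. by elim: n => //= n IH; rewrite mulr_ge0// addr_ge0// exprn_ge0. Qed.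

(** With [d = 1 - a n], the recursion is [d' = d - d^2 / 2]; it is monotone in [d] on
    [0, 1], and [2 / (n + 2)] decreases more slowly than it prescribes. *)
Lemma sqrt_bound_rate n : (1 - a n <= 2 / n.+2%:R) && (a n <= 1).
Proof.
elim: n => [|n /andP[IH an]]; first by rewrite /= subr0 divff// lexx ler01.
rewrite [a n.+1]/=; apply/andP; split; last first.
  by rewrite ler_pdivrMl// mulr1 (lerD (lexx 1))// expr_le1// sqrt_bound_ge0.
set e := 2 / _ in IH.
have e1 : e <= 1 by rewrite ler_pdivrMr// mul1r ler_nat.
apply: (@le_trans _ _ (e - e ^+ 2 / 2)).
  rewrite -subr_ge0.
  have -> : e - e ^+ 2 / 2 - (1 - 2^-1 * (1 + a n ^+ 2)) =
    (e - (1 - a n)) * ((1 - e) + a n) / 2 by field.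
  rewrite mulr_ge0// mulr_ge0 ?subr_ge0//.
  by rewrite addr_ge0 ?subr_ge0// sqrt_bound_ge0.
rewrite -subr_ge0 /e; set x : R[i] := n%:R.
have x0 : 0 <= x by [].
have -> : n.+2%:R = x + 2 :> R[i] by rewrite -natrD addn2.
have -> : n.+3%:R = x + 3 :> R[i] by rewrite -natrD addn3.
have [x2 x3] : x + 2 != 0 /\ x + 3 != 0 by split; rewrite gt_eqF// ltr_wpDl.
have -> : 2 / (x + 3) - (2 / (x + 2) - (2 / (x + 2)) ^+ 2 / 2) =
   2 / ((x + 3) * (x + 2) ^+ 2) by field; rewrite x2 x3.
by rewrite divr_ge0// mulr_ge0// ?exprn_ge0// addr_ge0.
Qed.

Lemma sqrt_boundS n : a n <= a n.+1.
Proof.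
rewrite -subr_ge0 /=.
have -> : 2^-1 * (1 + a n ^+ 2) - a n = 2^-1 * (1 - a n) ^+ 2 by field.
have /andP[_ an] := sqrt_bound_rate n.
by rewrite mulr_ge0// exprn_ge0// subr_ge0.
Qed.

Lemma sqrt_iter_op n : operator_on K (a n) (Z n).
Proof.
elim: n => [|n IH]; first exact: operator_on0.
have h : 0 <= 2^-1 :> R[i] by [].
have := operator_on_comp (sqrt_bound_ge0 n) IH IH.
move/(operator_onDZ sK 1 Bop)/(operator_onDZ sK 2^-1)/(_ (operator_on0 sK)).
congr operator_on.
  by rewrite /= normr1 mul1r addr0 ger0_norm// expr2.
by apply/funext => v; rewrite /= scale1r addr0.
Qed.

Lemma sqrt_iter_opC n v M f : operator_on K M f ->
  (forall v, K v -> f (B v) = B (f v)) -> K v -> f (Z n v) = Z n (f v).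
Proof.
move=> fo fB; elim: n v => [|n IH] v Kv /=.
  by rewrite -[X in f X](scale0r v) (operator_onZ sK _ fo)// scale0r.
have [ZK _ _] := sqrt_iter_op n; have [BK _ _] := Bop.
have KZ := ZK _ (ZK _ Kv).
rewrite (operator_onZ sK _ fo); last by apply: subspaceD => //; exact: BK.
by rewrite (operator_onD fo)// ?fB ?IH//; [exact: ZK|exact: BK].
Qed.

(** [Z'^2 - Z^2 = Z' (Z' - Z) + (Z' - Z) Z] has norm at most
    [(a' + a) (a' - a) = a'^2 - a^2]. *)
Lemma sqrt_iter_step n v : K v ->
  `|Z n.+1 v - Z n v| <= (a n.+1 - a n) * `|v|.
Proof.
elim: n v => [|n IH] v Kv.
  rewrite /= addr0 expr0n /= addr0 mulr1 !subr0 normrZ ger0_norm//.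
  have [_ _ Bn] := Bop.
  by rewrite ler_wpM2l// (le_trans (Bn _ Kv))// mul1r.
have [ZK _ Zn] := sqrt_iter_op n; have [ZK1 _ Zn1] := sqrt_iter_op n.+1.
have -> : Z n.+2 v - Z n.+1 v =
    2^-1 *: (Z n.+1 (Z n.+1 v - Z n v) + (Z n.+1 (Z n v) - Z n (Z n v))).
  rewrite (operator_onB (sqrt_iter_op n.+1)); [|exact: ZK1|exact: ZK].
  rewrite addrA subrK [Z n.+2 v]/= [X in _ - X = _]/= -scalerBr.
  by rewrite opprD addrACA subrr add0r.
rewrite normrZ ger0_norm//.
have -> : (a n.+2 - a n.+1) * `|v| =
    2^-1 * (a n.+1 * ((a n.+1 - a n) * `|v|) + (a n.+1 - a n) * (a n * `|v|)).
  rewrite [a n.+2]/=; have -> : a n.+1 = 2^-1 * (1 + a n ^+ 2) by [].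
  by field.
rewrite ler_wpM2l// (le_trans (ler_normD _ _))// lerD//.
  rewrite (le_trans (Zn1 _ _))//.
    by apply: subspaceB => //; [exact: ZK1|exact: ZK].
  by rewrite ler_wpM2l// ?sqrt_bound_ge0// IH.
by rewrite (le_trans (IH _ (ZK _ Kv)))// ler_wpM2l// ?Zn// subr_ge0 sqrt_boundS.
Qed.

Lemma sqrt_iter_dist n m v : K v -> (n <= m)%N ->
  `|Z m v - Z n v| <= 2 / n.+1%:R * `|v|.
Proof.
move=> Kv nm.
suff h : `|Z m v - Z n v| <= (a m - a n) * `|v|.
  rewrite (le_trans h)// ler_wpM2r//.
  have /andP[an _] := sqrt_bound_rate n; have /andP[_ am] := sqrt_bound_rate m.
  rewrite (@le_trans _ _ (1 - a n))// ?lerD2r// (le_trans an)//.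
  by rewrite ler_wpM2l// lef_pV2 ?posrE ?ltr0n// ler_nat.
rewrite -(subnKC nm); elim: (m - n)%N => [|k IH].
  by rewrite addn0 !subrr normr0 mul0r.
rewrite addnS -(subrK (Z (n + k)%N v) (Z _ v)) -addrA.
rewrite (le_trans (ler_normD _ _))//.
by rewrite -(subrK (a (n + k)%N) (a _)) -addrA mulrDl lerD// sqrt_iter_step.
Qed.

Lemma sqrt_iter_cvg v : K v -> Z n v @[n --> \oo] --> sqrt_compl v.
Proof.
move=> Kv; apply: cvgn_cauchy => e e0.
have k0 : 0 < 2 * `|v| + 1 by rewrite ltr_wpDl// mulr_ge0.
have [N Ne] := invn_small (divr_gt0 e0 k0).
exists N => m Nm; rewrite (le_trans (sqrt_iter_dist Kv Nm))//.
rewrite mulrAC (@le_trans _ _ ((2 * `|v| + 1) / N.+1%:R))//.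
  by rewrite ler_wpM2r ?invr_ge0// lerDl.
by rewrite mulrC -ler_pdivlMr// Ne.
Qed.

Lemma sqrt_compl_op : operator_on K 1 sqrt_compl.
Proof.
apply: (operator_on_lim sK cK (f := sqrt_iter)) => [n|v]; last first.
  exact: sqrt_iter_cvg.
by apply: operator_on_le (sqrt_iter_op n); have /andP[] := sqrt_bound_rate n.
Qed.

Lemma sqrt_compl_rate n v : K v ->
  `|Z n v - sqrt_compl v| <= 2 / n.+1%:R * `|v|.
Proof.
move=> Kv; rewrite distrC.
apply: (@le_norm_lim _ _ (fun m => Z m v - Z n v)).
  by exists n => // m /=; exact: sqrt_iter_dist.
by apply: cvgB; [exact: sqrt_iter_cvg|exact: cvg_cst].
Qed.

Lemma sqrt_compl_opC v M f : 0 <= M -> operator_on K M f ->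
  (forall v, K v -> f (B v) = B (f v)) -> K v ->
  f (sqrt_compl v) = sqrt_compl (f v).
Proof.
move=> M0 fo fB Kv; have [fK _ fM] := fo; have [ZK _ _] := sqrt_compl_op.
apply: (cvg_unique (@norm_hausdorff _ V) _ (sqrt_iter_cvg (fK _ Kv))).
apply: (@cvgn_rate _ _ _ _ (M * (2 * `|v|))) => n.
have [ZnK _ _] := sqrt_iter_op n.
rewrite -(sqrt_iter_opC _ fo)// -(operator_onB fo); [|exact: ZnK|exact: ZK].
rewrite (le_trans (fM _ _))//.
  by apply: subspaceB => //; [exact: ZnK|exact: ZK].
by rewrite -mulrA ler_wpM2l// mulrAC sqrt_compl_rate.
Qed.

Lemma sqrt_complE v : K v ->
  sqrt_compl v *+ 2 = B v + sqrt_compl (sqrt_compl v).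
Proof.
move=> Kv; have [ZK _ _] := sqrt_compl_op.
suff h : 2^-1 *: (B v + Z n (Z n v)) @[n --> \oo] -->
    2^-1 *: (B v + sqrt_compl (sqrt_compl v)).
  have := sqrt_iter_cvg Kv; rewrite -(cvg_shiftS (fun n => Z n v)) => h'.
  rewrite {1}(cvg_unique (@norm_hausdorff _ V) h' h).
  by rewrite -scaler_nat scalerA divff// scale1r.
apply: cvgZr; apply: cvgD; first exact: cvg_cst.
apply: (@cvgn_rate _ _ _ _ (2 * (`|v| + `|sqrt_compl v|))) => n.
have [ZnK _ Zn] := sqrt_iter_op n.
rewrite -(subrK (Z n (sqrt_compl v)) (Z n (Z n v))) -addrA.
rewrite -(operator_onB (sqrt_iter_op n)); [|exact: ZnK|exact: ZK].
rewrite (le_trans (ler_normD _ _))// mulrAC mulrDr lerD//; last first.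
  exact/sqrt_compl_rate/ZK.
rewrite (le_trans (Zn _ _))//.
  by apply: subspaceB => //; [exact: ZnK|exact: ZK].
rewrite -[leRHS]mul1r ler_pM// ?sqrt_bound_ge0// ?sqrt_compl_rate//.
by have /andP[] := sqrt_bound_rate n.
Qed.

End SquareRoot.

(** * A form of Schur's lemma *)

Section Schur.
Variables (R : realType) (G : groupType) (V : hilbert R).
Variables (T : unitary_rep G V) (K : set V).

Lemma rep_norm g v : `|T g v| = `|v|.
Proof.
apply/eqP; rewrite -(@eqrXn2 _ 2)//; apply/eqP.
by rewrite -!hdot_norm rep_dot.
Qed.

Lemma rep_operator_on g : is_subrep T K -> operator_on K 1 (T g).
Proof.
move=> [_ _ KT]; split=> [v Kv|a u v _ _|v _]; first exact: KT.
  by rewrite linearP.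
by rewrite rep_norm mul1r.
Qed.

Lemma kernel_subrep M f : 0 <= M -> is_subrep T K -> operator_on K M f ->
  (forall g v, K v -> f (T g v) = T g (f v)) ->
  is_subrep T [set v | K v /\ f v = 0].
Proof.
move=> M0 [sK cK KT] fo fT; have [fK fl fM] := fo; split.
- split=> [|a u v [Ku fu] [Kv fv]].
    split; first exact: subspace0.
    rewrite -(scale0r (0 : V)) (operator_onZ sK _ fo) ?scale0r//.
    exact: subspace0.
  by split; [case: sK => _; apply|rewrite fl// fu fv scaler0 addr0].
- move=> v Wv; have Kv : K v.
    apply: cK; apply/closure_normP => e e0.
    by have /closure_normP/(_ e e0)[w [Kw _] vw] := Wv; exists w.
  split=> //; apply/eqP; rewrite -normr_le0; apply/ler_addgt0Pr => e e0.
  rewrite add0r; have k0 : 0 < M + 1 by rewrite ltr_wpDl.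
  have /closure_normP/(_ _ (divr_gt0 e0 k0))[w [Kw fw] vw] := Wv.
  rewrite -[f v]subr0 -fw -(operator_onB fo)// (le_trans (fM _ _))//.
    exact: subspaceB.
  rewrite (@le_trans _ _ ((M + 1) * `|v - w|))//.
    by rewrite ler_wpM2r// lerDl.
  by rewrite mulrC -ler_pdivlMr// ltW.
- by move=> g v [Kv fv]; split; [exact: KT|rewrite fT// fv linear0].
Qed.

(** The invariant subspace is [ker (A - S)] for [A = sqrt (S^2) = 1 - Z].  It cannot
    be all of [K], nor can [ker (A + S)]: if [A x = s S x] with [|s| = 1], then
    [<Z x, x> = <x, x>] because [<S x, x> = 0], and as [Z] is a contraction this is
    the equality case of Cauchy-Schwarz, so [Z x = x] and [S x = 0]. *)
Theorem reducible_of_intertwiner S x : is_subrep T K -> operator_on K 1 S ->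
  (forall u v, K u -> K v -> hdot V (S u) v = hdot V u (S v)) ->
  (forall g v, K v -> S (T g v) = T g (S v)) ->
  K x -> hdot V (S x) x = 0 -> S x != 0 -> reducible T K.
Proof.
move=> rK So Ssym ST Kx Sxx Sx0; have [sK cK KT] := rK.
have [SK _ Sn] := So.
pose B v := v - S (S v).
have SSo : operator_on K 1 (S \o S).
  by rewrite -[X in operator_on _ X]mul1r; exact: operator_on_comp.
have Bop : operator_on K 1 B.
  have BE : (fun v => -1 *: (S \o S) v + id v) = B.
    by apply/funext => v; rewrite scaleN1r addrC.
  have := operator_onDZ sK (-1) SSo (operator_on_id K); rewrite BE.
  move=> [BK Bl _]; split=> // v Kv.
  rewrite mul1r -(@ler_pXn2r _ 2)// ?nnegrE// norm2B.
  rewrite -Ssym//; last exact: SK.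
  rewrite hdot_norm rmorphXn /= (CrealP (normr_real _)).
  have S1 w : K w -> `|S w| ^+ 2 <= `|w| ^+ 2.
    by move=> Kw; rewrite ler_pXn2r ?nnegrE// (le_trans (Sn _ Kw))// mul1r.
  rewrite -addrA gerDl addrC subr_le0 (le_trans (S1 _ (SK _ Kv)))//.
  by rewrite lerDl exprn_ge0.
pose Z := sqrt_compl B.
have Zo : operator_on K 1 Z := sqrt_compl_op sK cK Bop.
have [ZK _ Zn] := Zo.
have ZS v : K v -> S (Z v) = Z (S v).
  move=> Kv; apply: (sqrt_compl_opC sK cK Bop ler01 So) => // {}v {}Kv.
  by rewrite /B (operator_onB So)//; exact/SK/SK.
have ZT g v : K v -> T g (Z v) = Z (T g v).
  move=> Kv; have To := rep_operator_on g rK.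
  apply: (sqrt_compl_opC sK cK Bop ler01 To) => //.
  by move=> {}v {}Kv; rewrite /B linearB /= !ST//; exact: SK.
have ZE v : K v -> Z v *+ 2 = v - S (S v) + Z (Z v).
  by move=> Kv; exact: (sqrt_complE sK cK Bop).
have Do s : operator_on K (`|s| * 1 + (`|-1| * 1 + 1))
    (fun v => s *: S v + (-1 *: Z v + v)).
  apply: operator_onDZ => //; apply: operator_onDZ => //; exact: operator_on_id.
have DT s g v : K v ->
    s *: S (T g v) + (-1 *: Z (T g v) + T g v) =
    T g (s *: S v + (-1 *: Z v + v)).
  by move=> Kv; rewrite ST// -ZT// !linearD !linearZ.
have kerD s : is_subrep T [set v | K v /\ s *: S v + (-1 *: Z v + v) = 0].
  by apply: kernel_subrep rK (Do s) (DT s); rewrite !addr_ge0// mulr_ge0.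
have notx s : s * s^*%R = 1 -> s *: S x + (-1 *: Z x + x) <> 0.
  move=> ss E; move/eqP: Sx0; apply.
  have ZxE : Z x = s *: S x + x.
    by apply/eqP; rewrite eq_sym -subr_eq0 -E scaleN1r addrAC addrA addrAC.
  have : `|Z x - x| ^+ 2 <= 0.
    rewrite norm2B {2 3}ZxE hdotDl hdotZl Sxx mulr0 add0r hdot_norm.
    rewrite rmorphXn /= (CrealP (normr_real _)) opprD addrA subrK subr_le0.
    by rewrite ler_pXn2r ?nnegrE// (le_trans (Zn _ Kx))// mul1r.
  rewrite ZxE addrK -hdot_norm hdotZl hdotZr mulrA ss mul1r hdot_norm.
  move=> h; have : `|S x| ^+ 2 == 0 by rewrite eq_le h exprn_ge0.
  by rewrite expf_eq0 normr_eq0 => /eqP.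
exists [set v | K v /\ -1 *: S v + (-1 *: Z v + v) = 0]; split=> //.
- by move=> v [].
- (* if no nonzero [v] in [K] satisfies [(1 - Z) v = S v], then [1 - Z = - S] on [K],
     as [(1 - Z - S) ((1 - Z) + S) = 0] *)
  apply/eqP => W0; apply: (notx 1); first by rewrite rmorph1 mulr1.
  suff : [set 0] (1 *: S x + (-1 *: Z x + x)) by [].
  rewrite -W0 /=; have KS := SK _ Kx; have KZ := ZK _ Kx.
  rewrite scale1r scaleN1r (addrC _ x); split.
    by apply: subspaceD => //; exact: subspaceB.
  have KxZ : K (x - Z x) by exact: subspaceB.
  have AA : x - Z x - Z (x - Z x) = S (S x).
    rewrite (operator_onB Zo)// opprB addrA -addrA (addrAC x) -!addrA.
    rewrite -opprD -mulr2n ZE// opprD (addrCA (Z (Z x))) subrr addr0.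
    by rewrite opprB addrC subrK.
  have AS : S x - Z (S x) = S (x - Z x) by rewrite (operator_onB So)// ZS.
  apply/eqP; rewrite !scaleN1r [X in X == _]addrC subr_eq0 (addrC (- _)).
  by rewrite (operator_onD Zo)// opprD addrACA AS AA addrC -(operator_onD So).
- apply/eqP => WK; have : K x := Kx; rewrite -WK => -[_].
  by apply: notx; rewrite rmorphN rmorph1 mulrNN mulr1.
Qed.

End Schur.

(** * Cyclic subrepresentations *)

Section CyclicSubrep.
Variables (R : realType) (G : groupType) (V : hilbert R).
Variables (T : unitary_rep G V) (x : V).

Lemma smallest_subspace (A : set V) :
  is_subspace (smallest (@is_subspace R V) A).
Proof.
split=> [B [[B0 _] _]//|a u v Au Av B [sB AB]].
by case: (sB) => _; apply; [exact: Au|exact: Av].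
Qed.

Lemma closure_subspace (A : set V) : is_subspace A -> is_subspace (closure A).
Proof.
move=> sA; split=> [|a u v Au Av].
  by apply: subset_closure; exact: subspace0.
apply/closure_normP => e e0.
have k0 : 0 < `|a| + 1 by rewrite ltr_wpDl.
have h0 : 0 < e / (2 * (`|a| + 1)) by rewrite divr_gt0// mulr_gt0.
have /closure_normP/(_ _ h0)[u' Au' uu'] := Au.
have /closure_normP/(_ _ (divr_gt0 e0 (ltr0Sn _ 1)))[v' Av' vv'] := Av.
exists (a *: u' + v'); first by case: sA => _; apply.
rewrite opprD addrACA -scalerBr (le_lt_trans (ler_normD _ _))//.
rewrite [ltRHS](splitr e) ler_ltD// normrZ.
rewrite (@le_trans _ _ ((`|a| + 1) * `|u - u'|))//.
  by rewrite ler_wpM2r// lerDl.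
rewrite (le_trans (ler_wpM2l (ltW k0) (ltW uu')))//.
suff -> : (`|a| + 1) * (e / (2 * (`|a| + 1))) = e / 2 by [].
by field; rewrite gt_eqF.
Qed.

Lemma cyclic_subrep_is_subrep : is_subrep T (cyclic_subrep T x).
Proof.
pose A := smallest (@is_subspace R V) (rep_orbit T x).
have sA : is_subspace A := smallest_subspace _.
split; [exact: closure_subspace|exact: closed_closure|].
move=> g u Au; apply/closure_normP => e e0.
have /closure_normP/(_ _ e0)[w Aw uw] := Au.
exists (T g w); last by rewrite -linearB rep_norm.
have : A `<=` [set v | A (T g v)].
  apply: smallest_sub.
    split=> [|a y z /= Ay Az]; first by rewrite /= linear0; exact: subspace0.
    by rewrite linearP; case: sA => _; apply.
  move=> _ [h _ <-] /=; rewrite -repM.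
  by apply: sub_gen_smallest; exists (g * h)%g.
exact.
Qed.

Lemma cyclic_subrep_gen : cyclic_subrep T x x.
Proof.
apply: subset_closure; apply: sub_gen_smallest.
by exists 1%g => //; rewrite rep1.
Qed.

Lemma cyclic_subrep_ind (P : set V) : is_subspace P -> closed P ->
  (forall g, P (T g x)) -> cyclic_subrep T x `<=` P.
Proof.
move=> sP cP Px; have -> : P = closure P by exact/closure_id.
apply: closureS.
by apply: smallest_sub => // _ [g _ <-].
Qed.

End CyclicSubrep.

(** * Averages of an exchangeable sequence of involutions *)

Section Exchangeable.
Variables (R : realType) (G : groupType) (V : hilbert R).
Variables (T : unitary_rep G V) (tau : nat -> G) (x : V) (q c : R[i]).
Hypothesis tauK : forall j, (tau j * tau j = 1)%g.
Hypothesis tauC : forall g, exists n, forall j, (n <= j)%N ->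
  (tau j * g = g * tau j)%g.
Hypothesis tau_q : forall i j, i != j ->
  hdot V (T (tau i) x) (T (tau j) x) = q.
Hypothesis tau_c : forall j, hdot V (T (tau j) x) x = c.

Local Notation K := (cyclic_subrep T x).

Definition avg n (v : V) : V := n.+1%:R^-1 *: \sum_(j < n.+1) T (tau j) v.

Lemma avg_op (L : set V) n : is_subrep T L -> operator_on L 1 (avg n).
Proof.
move=> [sL _ LT]; split=> [v Lv|a u v Lu Lv|v Lv].
- apply: subspaceZ => //; elim/big_ind: _ => [|u w|i _]; last exact: LT.
    exact: subspace0.
  exact: subspaceD.
- rewrite /avg scalerA mulrC -scalerA -scalerDr; congr (_ *: _).
  by rewrite scaler_sumr -big_split; apply: eq_bigr => i _; rewrite linearP.
- rewrite mul1r normrZ ger0_norm ?invr_ge0// ler_pdivrMl//.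
  rewrite (le_trans (ler_norm_sum _ _ _))//.
  under eq_bigr do rewrite rep_norm.
  by rewrite sumr_const card_ord mulr_natl.
Qed.

(** Unitary involutions are self-adjoint. *)
Lemma avg_dot n (u v : V) : hdot V (avg n u) v = hdot V u (avg n v).
Proof.
rewrite hdotZl hdotZr fmorphV rmorph_nat hdot_suml hdot_sumr.
congr (_ * _); apply: eq_bigr => j _.
by rewrite -(rep_dot T (tau j)) -repM tauK rep1.
Qed.

Let e := `|x| ^+ 2.

(** Among the pairs [(i, j)] with [i <= n] and [j <= m], one in [m + 1] is diagonal. *)
Lemma avg_avg n m : (n <= m)%N ->
  hdot V (avg n x) (avg m x) = q + (e - q) / m.+1%:R.
Proof.
move=> nm; rewrite hdotZl hdotZr fmorphV rmorph_nat hdot_suml.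
have mn0 : m.+1%:R != 0 :> R[i] by rewrite pnatr_eq0.
have nn0 : n.+1%:R != 0 :> R[i] by rewrite pnatr_eq0.
have row (i : 'I_n.+1) : hdot V (T (tau i) x) (\sum_(j < m.+1) T (tau j) x) =
    m.+1%:R * q + (e - q).
  rewrite hdot_sumr (bigD1 (widen_ord (nm : n.+1 <= m.+1)%N i))//= hdot_norm.
  rewrite rep_norm (eq_bigr (fun=> q)) => [|j ji]; last first.
    by rewrite tau_q//; move: ji; rewrite -val_eqE eq_sym.
  rewrite sumr_const cardC1 card_ord -mulr_natl -natr1 -/e; ring.
under eq_bigr do rewrite row.
rewrite sumr_const card_ord -[(_ + _) *+ _]mulr_natl.
move: mn0 nn0; move: (_%:R) (n.+1%:R) => M N M0 N0.
by field; rewrite M0 N0.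
Qed.

Lemma avg_dist n m : (n <= m)%N ->
  `|avg m x - avg n x| ^+ 2 <= `|e - q| / n.+1%:R.
Proof.
move=> nm.
have qC : q^*%R = q by rewrite -{1}(@tau_q 0 1)// -hdotC tau_q.
have eC : e^*%R = e by rewrite rmorphXn /= (CrealP (normr_real _)).
have E : `|avg m x - avg n x| ^+ 2 = (e - q) * (n.+1%:R^-1 - m.+1%:R^-1).
  rewrite distrC norm2B -!hdot_norm !avg_avg//.
  rewrite rmorphD rmorphM rmorphB fmorphV rmorph_nat /= eC qC.
  have : m.+1%:R != 0 :> R[i] by rewrite pnatr_eq0.
  have : n.+1%:R != 0 :> R[i] by rewrite pnatr_eq0.
  move: (n.+1%:R) (m.+1%:R) => N M N0 M0.
  by field; rewrite M0 N0.
have h : 0 <= n.+1%:R^-1 - m.+1%:R^-1 :> R[i].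
  by rewrite subr_ge0 lef_pV2 ?posrE ?ltr0n// ler_nat ltnS.
rewrite -[leLHS]ger0_norm ?exprn_ge0// E normrM ler_wpM2l// (ger0_norm h).
by rewrite gerBl invr_ge0.
Qed.

(** Only the finitely many [tau j] that do not commute with [g] contribute to the
    commutator with the average. *)
Lemma avg_comm g v : exists k : R[i], forall n,
  `|avg n (T g v) - T g (avg n v)| <= k / n.+1%:R.
Proof.
have [m mC] := tauC g; exists (m%:R * (2 * `|v|)) => n.
rewrite /avg linearZ [T g (\sum_(_ < _) _)]linear_sum /= -scalerBr -sumrB.
rewrite normrZ ger0_norm ?invr_ge0//.
rewrite mulrC ler_wpM2r ?invr_ge0//.
rewrite (le_trans (ler_norm_sum _ _ _))//.
rewrite (bigID (fun i : 'I_n.+1 => (i < m)%N))/=.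
rewrite [X in _ + X]big1 ?addr0; last first.
  by move=> i; rewrite -leqNgt => mi; rewrite -!repM mC// subrr normr0.
rewrite (@le_trans _ _ (\sum_(i < n.+1 | (i < m)%N) 2 * `|v|))//.
  apply: ler_sum => i _; rewrite (le_trans (ler_normB _ _))// !rep_norm.
  by rewrite mulr_natl mulr2n.
rewrite sumr_const -[_ *+ #|_|]mulr_natl ler_wpM2r ?mulr_ge0// ler_nat.
rewrite cardE -(size_map val) -[leqRHS](size_iota 0); apply: uniq_leq_size.
  by rewrite map_inj_uniq ?enum_uniq//; exact: val_inj.
by move=> _ /mapP[i + ->]; rewrite mem_enum mem_iota.
Qed.

Let rK : is_subrep T K := cyclic_subrep_is_subrep T x.
Let sK : is_subspace K. Proof. by case: rK. Qed.
Let cK : closed K. Proof. by case: rK. Qed.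
Let Kx : K x := @cyclic_subrep_gen _ _ _ T x.

Let rT : is_subrep T setT.
Proof. by split=> //; exact: closedT. Qed.

Lemma avg_cvg_rep g v l :
  avg n v @[n --> \oo] --> l -> avg n (T g v) @[n --> \oo] --> T g l.
Proof.
move=> vl; have [k kP] := avg_comm g v.
have : (avg n (T g v) - T g (avg n v)) @[n --> \oo] --> (0 : V).
  by apply: (@cvgn_rate _ _ _ _ k) => n; rewrite subr0.
have : T g (avg n v) @[n --> \oo] --> T g l.
  apply/cvgrPdist_le => d d0; move/cvgrPdist_le/(_ d d0) : vl.
  by apply: filterS => n; rewrite -linearB rep_norm.
move=> h1 h2; rewrite -[T g l]add0r.
have -> : (fun n => avg n (T g v)) =
    (fun n => (avg n (T g v) - T g (avg n v)) + T g (avg n v)).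
  by apply/funext => n; rewrite subrK.
exact: cvgD h2 h1.
Qed.

(** The averages converge at [x] by [avg_dist], hence on its orbit by
    [avg_cvg_rep]; the vectors where they converge form a subspace, closed because
    the averages are uniformly bounded. *)
Lemma avg_cvg v : K v -> cvgn (fun n => avg n v).
Proof.
move: v; apply: cyclic_subrep_ind.
- split=> [|a u v /= cu cv].
    have -> : (fun n => avg n 0) = (fun=> 0).
      have [sT _ _] := rT.
      apply/funext => n; rewrite -{1}(scale0r (0 : V)).
      by rewrite (operator_onZ sT _ (avg_op n rT))// scale0r.
    exact: is_cvg_cst.
  have -> : (fun n => avg n (a *: u + v)) = (fun n => a *: avg n u + avg n v).
    by apply/funext => n; have [_ -> //] := avg_op n rT.
  by apply: is_cvgD => //; exact: is_cvgZr.
- move=> v Dv; apply: cvgn_cauchy => d d0.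
  have d3 : 0 < d / 3 by rewrite divr_gt0.
  have /closure_normP/(_ _ d3)[w /cvg_ex[l wl] vw] := Dv.
  have {wl} : \forall n \near \oo, `|l - avg n w| <= d / 6.
    by move/cvgrPdist_le : wl; apply; rewrite divr_gt0.
  move=> [N _ Nw]; exists N => m Nm.
  have B n : `|avg n v - avg n w| <= d / 3.
    have Ao := avg_op n rT; rewrite -(operator_onB Ao)//.
    by have [_ _ Ab] := Ao; rewrite (le_trans (Ab _ _))// mul1r ltW.
  have -> : avg m v - avg N v = (avg m v - avg m w) +
     ((l - avg N w) - (l - avg m w)) - (avg N v - avg N w).
    by rewrite !opprB (addrC (l - _)) !subrKA.
  rewrite (le_trans (ler_normB _ _))//.
  have -> : d = d / 3 + (d / 6 + d / 6) + d / 3 by field.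
  rewrite lerD// (le_trans (ler_normD _ _))// lerD//.
  by rewrite (le_trans (ler_normB _ _))// lerD// Nw /=.
- move=> g; have : cvgn (fun n => avg n x).
    apply: cvgn_cauchy => d d0.
    have k0 : 0 < `|e - q| + 1 by rewrite ltr_wpDl.
    have [N Ne] := invn_small (divr_gt0 (exprn_gt0 2 d0) k0).
    exists N => m Nm; rewrite -(@ler_pXn2r _ 2)// ?nnegrE ?(ltW d0)//.
    apply: le_trans (avg_dist Nm) _.
    rewrite (@le_trans _ _ ((`|e - q| + 1) / N.+1%:R))//.
      by rewrite ler_wpM2r ?invr_ge0// lerDl.
    by rewrite mulrC -ler_pdivlMr// Ne.
  move=> /cvg_ex[l xl]; apply/cvg_ex; exists (T g l); exact: avg_cvg_rep.
Qed.

Let C v := lim (avg n v @[n --> \oo]).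

Let Ccvg v : K v -> avg n v @[n --> \oo] --> C v.
Proof. exact: avg_cvg. Qed.

Let Cop : operator_on K 1 C.
Proof.
apply: (operator_on_lim sK cK (f := avg)) => [n|]; last exact: Ccvg.
exact: avg_op.
Qed.

Let CT g v : K v -> C (T g v) = T g (C v).
Proof.
move=> Kv; have KTv : K (T g v) by case: rK => _ _; exact.
apply: (cvg_unique (@norm_hausdorff _ V) (Ccvg KTv)).
exact: avg_cvg_rep (Ccvg Kv).
Qed.

Let Csym u v : K u -> K v -> hdot V (C u) v = hdot V u (C v).
Proof.
move=> Ku Kv; have h := cvg_hdotl (v := v) (Ccvg Ku).
apply: (cvg_unique (@norm_hausdorff _ _) h).
have -> : (fun n => hdot V (avg n u) v) = (fun n => hdot V u (avg n v)).
  by apply/funext => n; exact: avg_dot.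
exact: cvg_hdotr (Ccvg Kv).
Qed.

Let C_mean : hdot V (C x) x = c.
Proof.
apply: (cvg_unique (@norm_hausdorff _ _) (cvg_hdotl (v := x) (Ccvg Kx))).
apply: cvg_near_cst; apply: nearW => n.
rewrite hdotZl hdot_suml; under eq_bigr do rewrite tau_c.
by rewrite sumr_const card_ord -[X in _ * X]mulr_natl mulKf// pnatr_eq0.
Qed.

Let C_norm : hdot V (C x) (C x) = q.
Proof.
apply: (cvg_unique (@norm_hausdorff _ _) (cvg_hdotl (v := C x) (Ccvg Kx))).
apply: cvg_near_cst; apply: nearW => n.
apply: (cvg_unique (@norm_hausdorff _ _) (cvg_hdotr (v := avg n x) (Ccvg Kx))).
apply/cvgrPdistC_le => d d0.
have k0 : 0 < `|e - q| + 1 by rewrite ltr_wpDl.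
have [N Ne] := invn_small (divr_gt0 d0 k0).
exists (maxn n N) => // m /=; rewrite geq_max => /andP[nm Nm].
rewrite avg_avg// addrAC subrr add0r normrM [X in _ * X]ger0_norm ?invr_ge0//.
rewrite (@le_trans _ _ ((`|e - q| + 1) / m.+1%:R))//.
  by rewrite ler_wpM2r ?invr_ge0// lerDl.
by rewrite mulrC -ler_pdivlMr// Ne.
Qed.

(** The limit [C] of the averages has mean [c / e] and second moment [q / e] in the
    state [x / |x|]; a nonzero variance means that [x] is not an eigenvector of [C]. *)
Theorem reducible_of_variance : q * e != c ^+ 2 -> reducible T K.
Proof.
move=> qc.
have e0 : e != 0.
  apply: contraNneq qc => e0; rewrite e0 mulr0 eq_sym expf_eq0 /=.
  move: e0 => /eqP; rewrite expf_eq0 /= normr_eq0 -(tau_c 0) => /eqP ->.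
  by rewrite (linear0r (hdot V)).
have eC : e^*%R = e by rewrite rmorphXn /= (CrealP (normr_real _)).
have cC : c^*%R = c by rewrite -C_mean -hdotC Csym.
(* [C - c / e] has norm at most [1 + |c / e|] on [K] *)
pose k := (1 + `|c / e|)^-1.
have k0 : 0 < 1 + `|c / e| by rewrite ltr_pwDl.
have kC : k^*%R = k by rewrite fmorphV /= (CrealP (gtr0_real k0)).
pose S v := k *: (- (c / e) *: v + C v) + 0.
have So : operator_on K 1 S.
  have := operator_onDZ sK (- (c / e)) (operator_on_id K) Cop.
  move/(operator_onDZ sK k)/(_ (operator_on0 sK)).
  rewrite normrN mulr1 addr0 ger0_norm ?invr_ge0 ?ltW// addrC mulVf ?gt_eqF//.
have SE v : S v = k *: (C v - (c / e) *: v).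
  by rewrite /S addr0 scaleNr addrC.
apply: (@reducible_of_intertwiner _ _ _ _ _ S x) => //.
- move=> u v Ku Kv; rewrite !SE hdotZl hdotZr hdotBl hdotBr hdotZl hdotZr.
  by rewrite kC rmorphM fmorphV /= cC eC Csym.
- move=> g v Kv; rewrite !SE CT//.
  by rewrite [T g (k *: _)]linearZ [T g (_ - _)]linearB [T g (_ *: v)]linearZ.
- rewrite SE hdotZl hdotBl hdotZl C_mean hdot_norm -/e divfK// subrr mulr0//.
- rewrite SE scaler_eq0 invr_eq0 gt_eqF//= subr_eq0; apply: contraNneq qc => CE.
  rewrite -C_norm CE hdotZl hdotZr hdot_norm rmorphM fmorphV /= cC eC -/e.
  by apply/eqP; field.
Qed.

End Exchangeable.

Local Close Scope classical_set_scope.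

(** * Counting cycles *)

Section CycleCount.

Lemma cycles_conj n (s x : 'S_n) : cycles (s * x * s^-1)%g = cycles x.
Proof.
have porbitJ i : porbit (s * x * s^-1)%g i = s^-1%g @: porbit x (s i).
  have E k : ((s * x * s^-1) ^+ k)%g i = s^-1%g ((x ^+ k)%g (s i)).
    elim: k => [|k IH]; first by rewrite !expg0 !perm1 permK.
    by rewrite !expgSr !permM IH permKV.
  apply/setP => j; apply/porbitP/imsetP => [[k ->]|[u /porbitP[k ->] ->]].
    by exists ((x ^+ k)%g (s i)); [exact: mem_porbit|exact: E].
  by exists k.
rewrite /cycles -(card_imset (porbits x) (imset_inj (@perm_inj _ s^-1%g))).
congr #|pred_of_set _|; apply/setP => A; apply/imsetP/imsetP.
  by move=> [i _ ->]; exists (porbit x (s i)); [exact: imset_f|rewrite porbitJ].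
move=> [_ /imsetP[i _ ->] ->]; exists (s^-1%g i) => //.
by rewrite porbitJ permKV.
Qed.

Definition one_line n (x : 'S_n) : seq nat := [seq val (x i) | i <- enum 'I_n].

Definition swap_fun (a b i : nat) : nat :=
  if i == a then b else if i == b then a else i.

(** A computable cycle count for a permutation in one-line notation: each cycle is
    counted at its least element, and [n] iterations exhaust a cycle. *)
Definition cycle_count (l : seq nat) : nat :=
  let n := size l in
  count (fun i => all (fun k => i <= iter k (nth 0%N l) i)%N (iota 0 n))
    (iota 0 n).

Lemma size_one_line n (x : 'S_n) : size (one_line x) = n.
Proof. by rewrite size_map size_enum_ord. Qed.

Lemma nth_one_line n (x : 'S_n) (i : 'I_n) : nth 0%N (one_line x) i = x i.
Proof. by rewrite (nth_map i) ?size_enum_ord// nth_ord_enum. Qed.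

Lemma cycle_countE n (x : 'S_n) : cycles x = cycle_count (one_line x).
Proof.
pose M := [set i | [forall j in porbit x i, (i <= j)%N]].
have minP i : (i \in M) =
    all (fun k => i <= iter k (nth 0%N (one_line x)) i)%N (iota 0 n).
  have iterE k : iter k (nth 0%N (one_line x)) i = iter k x i.
    by elim: k => //= k ->; rewrite nth_one_line.
  rewrite inE; apply/forall_inP/allP => [h k _|h j].
    by rewrite iterE -permX; apply: h; exact: mem_porbit.
  rewrite porbit_traject => /trajectP[k kn ->]; rewrite -iterE; apply: h.
  by rewrite mem_iota (leq_trans kn)// (leq_trans (max_card _))// card_ord.
have -> : cycles x = #|M|.
  rewrite /cycles; have -> : porbits x = porbit x @: M.
    apply/setP => A; apply/imsetP/imsetP => -[i iM ->]; last by exists i.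
    have [j ji jmin] := arg_minnP (@nat_of_ord n) (porbit_id x i).
    have E : porbit x i = porbit x j.
      by apply/eqP; rewrite eq_porbit_mem porbit_sym.
    exists j => //; rewrite inE; apply/forall_inP => k; rewrite -E; exact: jmin.
  rewrite card_in_imset// => i j; rewrite !inE.
  move=> /forall_inP iM /forall_inP jM ij.
  apply/val_inj/eqP; rewrite eqn_leq; apply/andP; split.
    by apply: iM; rewrite ij porbit_id.
  by apply: jM; rewrite -ij porbit_id.
rewrite cardE /enum_mem size_filter /cycle_count size_one_line.
set P := (X in _ = count X _).
by rewrite -(val_enum_ord n) count_map enumT; apply: eq_count => i; exact: minP.
Qed.

Lemma sum_one_line n (A : nmodType) (H : seq nat -> A) :
  \sum_(x : 'S_n) H (one_line x) = \sum_(l <- permutations (iota 0 n)) H l.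
Proof.
rewrite -big_enum -(big_map (@one_line n) predT H); apply: perm_big.
have inj : injective (@one_line n).
  move=> x y xy; apply/permP => i; apply: val_inj.
  by rewrite /= -!nth_one_line xy.
have u : uniq (map (@one_line n) (enum 'S_n)).
  by rewrite map_inj_uniq ?enum_uniq.
apply: uniq_perm => //; first exact: permutations_uniq.
apply: (uniq_min_size u _ _).2 => [l /mapP[x _ ->]|].
  rewrite mem_permutations; apply: uniq_perm; rewrite ?iota_uniq//.
    by rewrite map_inj_uniq ?enum_uniq// => i j /val_inj/perm_inj.
  move=> k; rewrite mem_iota /= add0n; apply/mapP/idP => [[i _ ->]|kn].
    exact: ltn_ord.
  by exists (x^-1%g (Ordinal kn)); rewrite ?mem_enum// permKV.
by rewrite size_permutations ?iota_uniq// size_iota size_map -cardE card_Sn.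
Qed.

Lemma one_line_tperm n (a b : 'I_n) (x : 'S_n) :
  one_line (tperm a b * x)%g =
  [seq nth 0%N (one_line x) (swap_fun a b i) | i <- iota 0 n].
Proof.
rewrite -(val_enum_ord n) -map_comp; apply: eq_map => i /=.
rewrite /swap_fun permM; case: tpermP => [->|->|/eqP ia /eqP ib].
- by rewrite eqxx nth_one_line.
- by case: eqP => [/val_inj ->|_]; rewrite ?eqxx nth_one_line.
- by rewrite -!val_eqE in ia ib; rewrite (negPf ia) (negPf ib) nth_one_line.
Qed.

End CycleCount.

(** * Sums over S(4) *)

Section SumS4.

(** The pairs of cycle counts of [(a b) x] and [(c d) x], for [x] in [S(4)];
    [a = b] is allowed and gives the identity. *)
Definition cycle_pairs (a b c d : nat) : seq (nat * nat) :=
  [seq (cycle_count [seq nth 0%N l (swap_fun a b i) | i <- iota 0 4],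
        cycle_count [seq nth 0%N l (swap_fun c d i) | i <- iota 0 4])
    | l <- permutations (iota 0 4)].

Lemma sum_S4_tperm (C : comNzRingType) (f g : nat -> C) (a b c d : 'I_4) :
  \sum_(x : 'S_4) f (cycles (tperm a b * x)%g) * g (cycles (tperm c d * x)%g) =
  \sum_(p <- cycle_pairs a b c d) f p.1 * g p.2.
Proof.
rewrite big_map -sum_one_line; apply: eq_bigr => x _.
by rewrite !cycle_countE !one_line_tperm.
Qed.

Lemma cycle_pairsE :
  [/\ perm_eq (cycle_pairs 0 1 2 3)
       (nseq 4 (3, 1) ++ nseq 10 (2, 2) ++ nseq 1 (4, 2) ++ nseq 2 (3, 3) ++
        nseq 4 (1, 3) ++ nseq 1 (2, 4) ++ nseq 2 (1, 1)),
      perm_eq (cycle_pairs 0 1 0 0)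
       (nseq 5 (3, 2) ++ nseq 5 (2, 3) ++ nseq 1 (4, 3) ++ nseq 1 (3, 4) ++
        nseq 6 (2, 1) ++ nseq 6 (1, 2)) &
      perm_eq (cycle_pairs 0 0 0 0)
       (nseq 11 (2, 2) ++ nseq 6 (3, 3) ++ nseq 1 (4, 4) ++ nseq 6 (1, 1))]%N.
Proof. by vm_compute. Qed.

(** Up to normalization, the left side is [q * |xi|^2 - c^2] for [u = z] and
    [v = z^*].  With [t = u v] and [p = u + v], the last factor of the right side is
    [(1 + t)^2 - p^2]. *)
Lemma variance_S4 (C : comNzRingType) (u v : C) :
  let S a b c d := \sum_(p <- cycle_pairs a b c d) u ^+ p.1 * v ^+ p.2 in
  S 0%N 1%N 2%N 3%N * S 0%N 0%N 0%N 0%N - S 0%N 1%N 0%N 0%N ^+ 2 =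
  2 * (u * v) ^+ 2 * (u * v + 2) * (u * v + 3) *
    ((1 - u) * (1 - v) * ((1 + u) * (1 + v))).
Proof.
have [pq pc pe] := cycle_pairsE.
rewrite /= (perm_big _ pq) (perm_big _ pc) (perm_big _ pe).
by rewrite /= !big_cons !big_nil /=; ring.
Qed.

End SumS4.

(** * Transpositions in the infinite symmetric group *)

Section Swaps.

Lemma swap_funK a b : involutive (swap_fun a b).
Proof.
move=> i; rewrite /swap_fun; case: (eqVneq i a) => [->|ia].
  by case: (eqVneq b a) => [->|]; rewrite ?eqxx.
case: (eqVneq i b) => [->|ib]; first by rewrite eqxx.
by rewrite (negPf ia) (negPf ib).
Qed.

Lemma swap_fun_fin a b : exists n, forall i, (n <= i)%N -> swap_fun a b i = i.
Proof.
exists (maxn a b).+1 => i; rewrite gtn_max => /andP[ai bi].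
by rewrite /swap_fun !gtn_eqF.
Qed.

Definition swap a b : Sinf :=
  MkSinf (swap_funK a b) (swap_funK a b) (swap_fun_fin a b).

Lemma ext_sinf_tperm n (a b : 'I_n) : ext_sinf (tperm a b) = swap a b.
Proof.
apply: sinf_eq => i; rewrite /= /ext_fun /swap_fun; case: insubP => [j _ <-|].
  case: tpermP => [->|->|/eqP ja /eqP jb].
  - by rewrite eqxx.
  - by case: eqP => [->|]; rewrite ?eqxx.
  - by rewrite -!val_eqE in ja jb; rewrite (negPf ja) (negPf jb).
by case: eqP => [->|_]; [rewrite ltn_ord|case: eqP => [->|//]; rewrite ltn_ord].
Qed.

Lemma ext_sinf1 n : ext_sinf (1 : 'S_n)%g = 1%g.
Proof.
apply: sinf_eq => i; rewrite /= /ext_fun; case: insubP => [j _ <-|//].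
by rewrite perm1.
Qed.

Lemma swapC (s : Sinf) a b : (s * swap a b = swap (s a) (s b) * s)%g.
Proof.
apply: sinf_eq => i /=; rewrite /swap_fun !(can_eq (@sinf_funK s)).
by do 2!case: ifP => // _.
Qed.

Definition tau j : Ginf := (swap j.*2 j.*2.+1, 1%g).

Lemma tauK j : (tau j * tau j = 1)%g.
Proof.
congr pair; last exact: mulg1.
by apply: sinf_eq => i; exact: swap_funK.
Qed.

Lemma tau_comm (g : Ginf) : exists n, forall j, (n <= j)%N ->
  (tau j * g = g * tau j)%g.
Proof.
have [n gn] := sinf_fin g.1; exists n => j nj.
have j2 : (j <= j.*2)%N by rewrite -addnn leq_addr.
congr pair; last by rewrite mulg1 mul1g.
by rewrite /= swapC !gn// ?(leq_trans nj)// leqW.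
Qed.

End Swaps.

(** * The distinguished vector *)

Section Main.
Variables (R : realType) (z : R[i]) (T : genreg z) (xi : genreg_space T).
Hypothesis hxi : is_distinguished xi.

Definition diag_fix (s : Sinf) : Prop := T (s, s) xi = xi.

Lemma diag_fix1 : diag_fix 1%g. Proof. exact: rep1. Qed.

Lemma diag_fixM s t : diag_fix s -> diag_fix t -> diag_fix (s * t)%g.
Proof.
by rewrite /diag_fix => sx tx; rewrite -[in RHS]sx -[in RHS]tx -repM.
Qed.

Lemma diag_fix_swap a b : diag_fix (swap a b).
Proof.
pose n := (maxn a b).+1.
have an : (a < n)%N by rewrite ltnS leq_maxl.
have bn : (b < n)%N by rewrite ltnS leq_maxr.
pose t := tperm (Ordinal an) (Ordinal bn).
have tE : (swap a b, swap a b) = ext_ginf (t, t).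
  by rewrite /ext_ginf ext_sinf_tperm.
rewrite /diag_fix tE (hxi (n := n))// incl_rep//.
have -> // : Reg (t, t) (Fz z n) = Fz z n :> {ffun 'S_n -> R[i]^o}.
by apply/ffunP => x; rewrite !ffunE /= cycles_conj.
Qed.

(** The letters are put in place one at a time: a swap that moves the image of [a]
    to [b] leaves the letters already placed unchanged. *)
Lemma diag_fix_transport (s t : seq nat) :
  uniq s -> uniq t -> size s = size t ->
  exists2 g : Sinf, diag_fix g & map g s = t.
Proof.
elim: s t => [|a s IH] [|b t]//=; first by exists 1%g => //; exact: diag_fix1.
move=> /andP[sa us] /andP[tb ut] [st]; have [g gx gE] := IH t us ut st.
exists (swap (g a) b * g)%g.
  by apply: diag_fixM => //; exact: diag_fix_swap.
congr cons; first by rewrite /= /swap_fun eqxx.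
rewrite -gE; apply/eq_in_map => i si /=; rewrite /swap_fun.
rewrite (can_eq (@sinf_funK g)); case: eqP => [ia|_].
  by rewrite -ia si in sa.
by case: eqP => // gib; rewrite -gib -gE map_f in tb.
Qed.

(** The value of [Fz z 4] on the permutations with [k] cycles. *)
Definition coef k : R[i] :=
  if z == 0 then (if k == 1%N then sqrtC 4%:R else 0)
  else sqrtC (4`!%:R / \prod_(i < 4) (tpar z + i%:R)) * z ^+ k.

Definition swap_dot a b c d : R[i] :=
  4`!%:R^-1 * \sum_(p <- cycle_pairs a b c d) coef p.1 * (coef p.2)^*%R.

Lemma hdot_swap (a b c d : 'I_4) :
  hdot _ (T (swap a b, 1%g) xi) (T (swap c d, 1%g) xi) = swap_dot a b c d.
Proof.
have E (a' b' : 'I_4) : (swap a' b', 1%g) = ext_ginf (tperm a' b', 1%g).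
  by rewrite /ext_ginf /= ext_sinf_tperm ext_sinf1.
rewrite !E (hxi (n := 4))// !incl_rep// incl_dot// /L2dot /swap_dot.
congr (_ * _).
rewrite -(sum_S4_tperm coef (fun k => (coef k)^*%R)).
by apply: eq_bigr => x _; rewrite !ffunE /= !invg1 !mulg1.
Qed.

Lemma swap_id a : swap a a = 1%g.
Proof.
by apply: sinf_eq => i /=; rewrite /swap_fun; case: eqP => [->//|].
Qed.

(** The diagonal element that carries [0, 1, 2, 3] to [2i, 2i+1, 2j, 2j+1] fixes
    [xi] and conjugates [tau 0], [tau 1] into [tau i], [tau j]. *)
Lemma tau_dot_indep i j : i != j ->
  hdot _ (T (tau i) xi) (T (tau j) xi) = swap_dot 0 1 2 3.
Proof.
move=> ij.
have u : uniq [:: i.*2; i.*2.+1; j.*2; j.*2.+1].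
  by rewrite /= !inE; lia.
have [g gx [g0 g1 g2 g3]] :=
  diag_fix_transport (isT : uniq [:: 0; 1; 2; 3]%N) u erefl.
have E k a b : g a = k.*2 -> g b = k.*2.+1 ->
    T (tau k) xi = T (g, g) (T (swap a b, 1%g) xi).
  move=> ga gb; rewrite -{1}gx -!repM; congr (T _ _); congr pair.
    by rewrite /= swapC ga gb.
  by rewrite /= mulg1 mul1g.
rewrite (E _ _ _ g0 g1) (E _ _ _ g2 g3) rep_dot.
exact: (@hdot_swap (@Ordinal 4 0 isT) (@Ordinal 4 1 isT) (@Ordinal 4 2 isT)
  (@Ordinal 4 3 isT)).
Qed.

Lemma tau_mean j : hdot _ (T (tau j) xi) xi = swap_dot 0 1 0 0.
Proof.
have [g gx [g0 g1]] := @diag_fix_transport [:: 0; 1]%N [:: j.*2; j.*2.+1]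
  isT ltac:(by rewrite /= inE; lia) erefl.
rewrite -{1 2}gx -repM.
have -> : (tau j * (g, g) = (g, g) * (swap 0 1, 1))%g.
  by congr pair; [rewrite /= swapC g0 g1|rewrite /= mulg1 mul1g].
rewrite repM rep_dot.
have T1 : T (swap 0 0, 1%g) xi = xi by rewrite swap_id; exact: rep1.
rewrite -[X in hdot _ _ X]T1.
exact: (@hdot_swap (@Ordinal 4 0 isT) (@Ordinal 4 1 isT) (@Ordinal 4 0 isT)
  (@Ordinal 4 0 isT)).
Qed.

Lemma norm_distinguished : `|xi| ^+ 2 = swap_dot 0 0 0 0.
Proof.
rewrite -hdot_norm -(rep_dot T (swap 0 0, 1%g)).
exact: (@hdot_swap (@Ordinal 4 0 isT) (@Ordinal 4 0 isT) (@Ordinal 4 0 isT)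
  (@Ordinal 4 0 isT)).
Qed.

Lemma variance_neq0 : z <> 1 -> z <> -1 ->
  swap_dot 0 1 2 3 * swap_dot 0 0 0 0 != swap_dot 0 1 0 0 ^+ 2.
Proof.
move=> z1 zN1; rewrite -subr_eq0 /swap_dot.
have n0 : 4`!%:R != 0 :> R[i] by rewrite pnatr_eq0.
have [z0|z0] := eqVneq z 0.
  have [pq pc pe] := cycle_pairsE.
  rewrite (perm_big _ pq) (perm_big _ pc) (perm_big _ pe) /= !big_cons !big_nil.
  rewrite /coef z0 eqxx /= !rmorph0 !mul0r !mulr0 !add0r !addr0.
  (* only the pairs (1, 1) of 4-cycles contribute: two of them to [q], six to
     [|xi|^2] and none to [c] *)
  have s0 : sqrtC 4%:R * (sqrtC 4%:R)^*%R != 0 :> R[i].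
    have q0 : sqrtC 4%:R != 0 :> R[i] by rewrite sqrtC_eq0 pnatr_eq0.
    by apply: mulf_neq0; rewrite ?conjC_eq0.
  set s := sqrtC _ * _ in s0 *.
  move: (4`!%:R) n0 => n n0.
  have -> : n^-1 * (s + s) * (n^-1 * (s + (s + (s + (s + (s + s)))))) -
      (n^-1 * 0) ^+ 2 = 12 * (n^-1 * s) ^+ 2 by ring.
  apply: mulf_neq0; first by rewrite pnatr_eq0.
  by apply: expf_neq0; apply: mulf_neq0 s0; rewrite invr_eq0.
have t0 : 0 < tpar z by rewrite exprn_gt0// normr_gt0.
pose k := sqrtC (4`!%:R / \prod_(i < 4) (tpar z + i%:R)).
have k0 : k != 0.
  rewrite sqrtC_eq0 mulf_neq0// invr_neq0//; apply/prodf_neq0 => i _.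
  by rewrite gt_eqF// ltr_wpDr.
have factorE a b c d :
    \sum_(p <- cycle_pairs a b c d) coef p.1 * (coef p.2)^*%R =
    (k * k^*%R) * \sum_(p <- cycle_pairs a b c d) z ^+ p.1 * (z^*%R) ^+ p.2.
  rewrite mulr_sumr; apply: eq_bigr => p _.
  by rewrite /coef (negPf z0) -/k rmorphM rmorphXn /= mulrACA.
rewrite !factorE.
have := variance_S4 z z^*%R.
set S0 := \sum_(_ <- _) _; set S1 := \sum_(_ <- _) _.
set S2 := \sum_(_ <- _) _ => /= SE.
move: (4`!%:R) n0 => n n0.
have -> : n^-1 * (k * k^*%R * S0) * (n^-1 * (k * k^*%R * S1)) -
  (n^-1 * (k * k^*%R * S2)) ^+ 2 =
  (n^-1 * (k * k^*%R)) ^+ 2 * (S0 * S1 - S2 ^+ 2) by ring.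
have zz : z * z^*%R = tpar z by rewrite -normCK.
have u1 : 1 - z != 0 by rewrite subr_eq0; apply/eqP => /esym.
have u2 : 1 + z != 0 by rewrite addrC addr_eq0; apply/eqP.
have cneq (w : R[i]) : w != 0 -> w^*%R != 0 by rewrite conjC_eq0.
have v1 := cneq _ u1; have v2 := cneq _ u2.
rewrite rmorphB rmorph1 /= in v1; rewrite rmorphD rmorph1 /= in v2.
have kk0 := cneq _ k0.
have h (i : nat) : tpar z + i%:R != 0 by rewrite gt_eqF// ltr_wpDr.
have tz : tpar z != 0 by rewrite gt_eqF.
have [h2 h3] := (h 2%N, h 3%N).
rewrite SE zz; move: (tpar z) tz h2 h3 => t tz h2 h3.
by rewrite !(mulf_neq0, expf_neq0, invr_neq0, pnatr_eq0).
Qed.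

End Main.

Theorem proposition4p6p1 (R : realType) (z : R[i]) (hz1 : z <> 1) (hzN1 : z <> - 1)
    (T : genreg z) (xi : genreg_space T) (hxi : is_distinguished xi) :
  reducible T (cyclic_subrep T xi).
Proof.
apply: (@reducible_of_variance _ _ _ T tau xi
  (swap_dot z 0 1 2 3) (swap_dot z 0 1 0 0)).
- exact: tauK.
- exact: tau_comm.
- move=> i j; exact: tau_dot_indep.
- exact: tau_mean.
- by rewrite (norm_distinguished hxi); exact: variance_neq0.
Qed.
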